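(* Let $\mathbb{O}$ be an octonion algebra over a field $k$ of characteristic not two or three, and let $\mathfrak{g}$ be the Lie algebra of type $G_2$ described in the context, with $B_{\mathfrak{g}}(x,y)=-\frac13\mathrm{Tr}(\rho(x)\rho(y))$. The representation $\rho : \mathfrak{g} \rightarrow \mathfrak{so}(\mathrm{Im}(\mathbb{O}),B)$ of the quadratic Lie algebra $(\mathfrak{g},B_{\mathfrak{g}})$ is a special orthogonal representation.
   Context: For an orthogonal representation $\rho:\mathfrak{g}\to\mathfrak{so}(V,(\ ,\ ))$ of a finite-dimensional quadratic Lie algebra $(\mathfrak{g},B_{\mathfrak{g}})$ (a Lie algebra with a non-degenerate ad-invariant symmetric bilinear form), the moment map is the alternating bilinear map $\mu:V\times V\to\mathfrak{g}$ determined by $B_{\mathfrak{g}}(x,\mu(v,w))=(\rho(x)(v),w)$ for all $x\in\mathfrak{g}$, $v,w\in V$. Write $\mu(u,v)(w)$ for $\rho(\mu(u,v))(w)$. The representation is called special orthogonal if $$\mu(u,v)(w)+\mu(u,w)(v)=(u,v)w+(u,w)v-2(v,w)u\qquad\forall u,v,w\in V.$$ $\mathbb{O}$ is an octonion (Cayley) algebra over $k$, i.e. an $8$-dimensional unital composition algebra, with norm $q$ and conjugation $u\mapsto\bar u$, $q(u)=u\bar u$; $\mathrm{Im}(\mathbb{O})=\{u\in\mathbb{O}: \bar u=-u\}$; $B$ is the symmetric bilinear form with $B(u,u)=q(u)$. Left multiplication $\rho(u)(x)=ux$ ($u\in\mathrm{Im}(\mathbb{O})$, $x\in\mathbb{O}$)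 satisfies $\rho(u)^2=-q(u)\mathrm{Id}$, hence extends to an algebra morphism $\rho:C(\mathrm{Im}(\mathbb{O}),-q)\to\mathrm{End}(\mathbb{O})$ from the Clifford algebra (in which $u^2=-q(u)$). Let $C^2(\mathrm{Im}(\mathbb{O}),-q)$ be the span of the elements $uv-vu$ with $u,v\in\mathrm{Im}(\mathbb{O})$, a Lie algebra under the commutator. Set $\mathfrak{g}=\{x\in C^2(\mathrm{Im}(\mathbb{O}),-q): \rho(x)(1)=0\}$. It is a Lie algebra of type $G_2$, $\rho(\mathfrak{g})$ is the Lie algebra of derivations of $\mathbb{O}$, and by restriction to $\mathrm{Im}(\mathbb{O})$ one gets the $7$-dimensional fundamental representation $\rho:\mathfrak{g}\to\mathfrak{so}(\mathrm{Im}(\mathbb{O}),B)$. *)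

(* Defs.v *)
From HB Require Import structures.
From mathcomp Require Import all_boot all_order all_algebra all_field.
From mathcomp Require Import ring.
Set Implicit Arguments.
Unset Strict Implicit.
Unset Printing Implicit Defensive.

Import GRing.Theory.
Local Open Scope ring_scope.

Section BilinearForms.
Variable k : fieldType.

Definition bilinear_map (U V W : lmodType k) (f : U -> V -> W) : Prop :=
  (forall v, linear (f^~ v)) /\ (forall u, linear (f u)).

Definition bilinear_form (V : lmodType k) (b : V -> V -> k) : Prop :=
  (forall v, scalar (b^~ v)) /\ (forall u, scalar (b u)).

Definition nondegenerate (V : lmodType k) (b : V -> V -> k) : Prop :=
  forall u, (forall v, b u v = 0) -> u = 0.

Definition symmetric_form (V : lmodType k) (b : V -> V -> k) : Prop :=
  forall u v, b u v = b v u.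

Definition polar (V : lmodType k) (q : V -> k) (u v : V) : k :=
  q (u + v) - q u - q v.

Definition quadratic_map (V : lmodType k) (q : V -> k) : Prop :=
  (forall a u, q (a *: u) = a ^+ 2 * q u) /\ bilinear_form (polar q).

Definition endo_trace (V : vectType k) (f : 'End(V)) : k :=
  \tr (passmx.mxof (vbasis {:V}) (vbasis {:V}) f).

End BilinearForms.

Section SpecialOrthogonal.
Variables (k : fieldType) (L V : vectType k).
Variables (br : L -> L -> L) (BL : L -> L -> k).
Variables (form : V -> V -> k) (rho : L -> 'End(V)).

Definition lie_algebra : Prop :=
  [/\ bilinear_map br,
      forall x, br x x = 0
    & forall x y z, br x (br y z) + br y (br z x) + br z (br x y) = 0].

Definition quadratic_lie_algebra : Prop :=
  lie_algebra /\
  [/\ bilinear_form BL, symmetric_form BL, nondegenerate BL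
    & forall x y z, BL (br x y) z = BL x (br y z)].

Definition orthogonal_representation : Prop :=
  [/\ bilinear_form form, symmetric_form form & nondegenerate form] /\
  [/\ linear rho,
      forall x y v, rho (br x y) v = rho x (rho y v) - rho y (rho x v)
    & forall x v w, form (rho x v) w + form v (rho x w) = 0].

Definition moment_map (mu : V -> V -> L) : Prop :=
  [/\ bilinear_map mu,
      forall v, mu v v = 0
    & forall x v w, BL x (mu v w) = form (rho x v) w].

(* When BL is nondegenerate there is at most one moment map, so [exists mu]
   speaks of the moment map. *)
Definition special_orthogonal_representation : Prop :=
  [/\ quadratic_lie_algebra, orthogonal_representation
    & exists mu, moment_map mu /\ forall u v w,
        rho (mu u v) w + rho (mu u w) v =
          form u v *: w + form u w *: v - (2 * form v w) *: u].

End SpecialOrthogonal.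

(* An octonion algebra: an 8-dimensional unital composition algebra. *)
Record octonion_algebra (k : fieldType) := OctonionAlgebra {
  oct_sort :> vectType k;
  omul : oct_sort -> oct_sort -> oct_sort;
  oone : oct_sort;
  onorm : oct_sort -> k;
  oct_dim : \dim {:oct_sort} = 8%N;
  omul_bilinear : bilinear_map omul;
  omul1l : forall x, omul oone x = x;
  omul1r : forall x, omul x oone = x;
  onorm_quadratic : quadratic_map onorm;
  onorm_nondegenerate : nondegenerate (polar onorm);
  onormM : forall x y, onorm (omul x y) = onorm x * onorm y
}.

Section Octonions.
Variables (k : fieldType) (O : octonion_algebra k).

(* The usual conjugation, tr(x) 1 - x with tr(x) = polar x 1. *)
Definition oconj (x : O) : O := polar (@onorm k O) x (oone O) *: oone O - x.

Fact oconj_linear : linear oconj.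
Proof.
move=> a x y; rewrite /oconj; have [_ [bl _]] := onorm_quadratic O.
by rewrite bl scalerDl -scalerA scalerBr opprD addrACA.
Qed.
HB.instance Definition _ := GRing.isSemilinear.Build k O O _ oconj
  (GRing.semilinear_linear oconj_linear).

(* Halved so that oform u u = onorm u, see oform_diag. *)
Definition oform (x y : O) : k := 2^-1 * polar (@onorm k O) x y.

Definition octIm : {vspace O} := lker (linfun oconj + \1)%VF.

Lemma memv_octIm (u : O) : (u \in octIm) = (oconj u == - u).
Proof. by rewrite memv_ker add_lfunE id_lfunE lfunE /= addr_eq0. Qed.

Definition imform (u v : subvs_of octIm) : k := oform (vsval u) (vsval v).

Lemma polarC (V : lmodType k) (q : V -> k) u v : polar q u v = polar q v u.
Proof. by rewrite /polar [v + u]addrC addrAC. Qed.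

Lemma oform_diag (u : O) : 2%N \notin [pchar k] -> oform u u = onorm u.
Proof.
move=> k2; have nz2 : 2 != 0 :> k by move: k2; rewrite inE /=.
have [qZ _] := onorm_quadratic O.
rewrite /oform /polar -mulr2n -scaler_nat qZ; field.
exact: nz2.
Qed.

Lemma polar_mul (u w x y : O) :
  polar (@onorm k O) (omul u x) (omul w y)
    + polar (@onorm k O) (omul w x) (omul u y)
  = polar (@onorm k O) u w * polar (@onorm k O) x y.
Proof.
have [mDl mDr] := omul_bilinear O.
have addl a b c : omul (a + b) c = omul a c + omul b c :> O.
  by have := mDl c 1 a b; rewrite /= !scale1r.
have addr a b c : omul a (b + c) = omul a b + omul a c :> O.
  by have := mDr a 1 b c; rewrite /= !scale1r.
have same a b c : polar (@onorm k O) (omul a b) (omul a c)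
                  = onorm a * polar (@onorm k O) b c.
  by rewrite /polar -addr !onormM !mulrBr.
have [_ [bl br]] := onorm_quadratic O.
have paddl a b c : polar (@onorm k O) (a + b) c
    = polar (@onorm k O) a c + polar (@onorm k O) b c.
  by have := bl c 1 a b; rewrite /= scale1r mul1r.
have paddr a b c : polar (@onorm k O) c (a + b)
    = polar (@onorm k O) c a + polar (@onorm k O) c b.
  by have := br c 1 a b; rewrite /= scale1r mul1r.
have := same (u + w) x y; rewrite !addl !paddl !paddr !same => e.
have -> : polar (@onorm k O) u w = onorm (u + w) - onorm u - onorm w by [].
by rewrite 2!mulrBl -e; ring.
Qed.

Lemma oone_neq0 : oone O != 0.
Proof.
apply/eqP => one0; have := oct_dim O.
suff -> : {:O}%VS = 0%VS by rewrite dimv0.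
apply/eqP; rewrite -subv0; apply/subvP => x _; rewrite memv0.
have [mDl _] := omul_bilinear O; have := mDl x (-1) 0 0.
by rewrite /= scaler0 addr0 scaleN1r addNr -one0 omul1l one0 => ->.
Qed.

Lemma polar_im1 (u : O) : u \in octIm -> polar (@onorm k O) u (oone O) = 0.
Proof.
rewrite memv_octIm /oconj -subr_eq0 opprK subrK scaler_eq0.
by rewrite (negPf oone_neq0) orbF => /eqP.
Qed.

Lemma polar_mul_im (u x y : O) : u \in octIm ->
  polar (@onorm k O) (omul u x) y = - polar (@onorm k O) x (omul u y).
Proof.
move=> /polar_im1 u1; have := polar_mul u (oone O) x y.
by rewrite u1 mul0r !omul1l => /eqP; rewrite addr_eq0 => /eqP.
Qed.

Lemma omul_im_sq (u x : O) : u \in octIm ->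
  omul u (omul u x) = - onorm u *: x.
Proof.
move=> uI; apply/eqP; rewrite -subr_eq0 scaleNr opprK; apply/eqP.
apply: (@onorm_nondegenerate k O) => y.
have [_ [bl _]] := onorm_quadratic O.
rewrite addrC; have /= -> := bl y (onorm u) x (omul u (omul u x)).
rewrite (polar_mul_im _ _ uI) /= /polar.
have [_ mDr] := omul_bilinear O; have := mDr u 1 x y.
by rewrite !scale1r => <-; rewrite !onormM; ring.
Qed.

End Octonions.

Section Clifford.
Variables (k : fieldType) (V : lmodType k) (Q : V -> k).

(* (C, iota) is the Clifford algebra C(V, Q), in which v ^+ 2 = Q v, given by
   its universal property. *)
Definition is_clifford (C : algType k) (iota : {linear V -> C}) : Prop :=
  (forall v, iota v * iota v = (Q v)%:A) /\
  forall (A : algType k) (f : {linear V -> A}),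
    (forall v, f v * f v = (Q v)%:A) ->
    exists g : {lrmorphism C -> A}, (forall v, g (iota v) = f v) /\
      forall h : {lrmorphism C -> A}, (forall v, h (iota v) = f v) -> h =1 g.

End Clifford.

(* The Clifford algebra of a finite-dimensional space is finite-dimensional,
   whence the falgType below. *)
Section CliffordDegreeTwo.
Variables (k : fieldType) (V : vectType k) (C : falgType k).
Variable iota : {linear V -> C}.

Definition lbr (x y : C) : C := x * y - y * x.

(* The span of all lbr (iota u) (iota v), see sub_cliff2P; by bilinearity it is
   enough to let u and v run over a basis. *)
Definition cliff2 : {vspace C} :=
  <<[seq lbr (iota u) (iota v) | u <- vbasis {:V}, v <- vbasis {:V}]>>%VS.

Lemma sub_cliff2P (U : {vspace C}) :
  (cliff2 <= U)%VS <-> forall u v, lbr (iota u) (iota v) \in U.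
Proof.
split=> [/span_subvP sU u v|sU]; last first.
  by apply/span_subvP => x /allpairsP[[u v] [_ _ ->]]; apply: sU.
rewrite (coord_vbasis (memvf u)) (coord_vbasis (memvf v)).
rewrite /lbr !linear_sum /= mulr_suml mulr_sumr.
rewrite -sumrB rpred_sum // => i _; rewrite mulr_sumr mulr_suml -sumrB.
rewrite rpred_sum // => j _; rewrite !linearZ /=.
rewrite -!scalerAl -!scalerAr !scalerA [X in _ - X *: _]mulrC.
rewrite -scalerBr rpredZ // sU //.
by apply/allpairsP; exists ((vbasis fullv)`_i, (vbasis fullv)`_j);
  split=> //=; apply: mem_nth; rewrite size_tuple.
Qed.

Lemma lbr_cliff2 u v : lbr (iota u) (iota v) \in cliff2.
Proof. by apply/sub_cliff2P: u v. Qed.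

Lemma lbr_cliff2_closed (Q : V -> k) : (forall v, iota v * iota v = (Q v)%:A) ->
  forall x y, x \in cliff2 -> y \in cliff2 -> lbr x y \in cliff2.
Proof.
move=> sqQ.
have anti u v : iota u * iota v = (polar Q u v)%:A - iota v * iota u.
  rewrite /polar !scalerBl -!sqQ linearD mulrDl !mulrDr.
  move: (iota u * iota u) (iota u * iota v) (iota v * iota u) => a b c.
  by rewrite addrA [X in X - c]addrAC addrK -[a + b + c]addrA [a + _]addrC !addrK.
have act u v w : lbr (lbr (iota u) (iota v)) (iota w)
    = iota (2 *: (polar Q v w *: u - polar Q u w *: v)).
  have comm (a : k) (x : C) : a *: x + a *: x = x * a%:A + a%:A * x.
    by rewrite -scalerAl -scalerAr mul1r mulr1.
  have antiD x y : (polar Q x y)%:A = iota x * iota y + iota y * iota x.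
    by rewrite anti subrK.
  rewrite scaler_nat mulr2n linearD linearB !linearZ /= !scalerN addrACA -opprD !comm.
  rewrite !antiD /lbr !(mulrDl, mulrDr, mulNr, mulrN) !mulrA.
  move: (iota u) (iota v) (iota w) => a b c.
  rewrite !(opprD, opprK, addrA).
  move: (a * b * c) (b * a * c) (c * a * b) (c * b * a) => x1 x2 x3 x4.
  move: (a * c * b) (b * c * a) => x5 x6; rewrite ?(opprD, opprK, addrA).
  by rewrite [RHS](ACl (1*5*8*4*(2*7)*(3*6)))%AC /= !subrr !addr0.
have c2P (U : {vspace C}) (f : 'End(C)) :
    (forall u v, f (lbr (iota u) (iota v)) \in U) ->
    forall x, x \in cliff2 -> f x \in U.
  move=> fU x x2; rewrite memv_preim; apply: subvP x x2.
  by apply/sub_cliff2P => u v; rewrite -memv_preim.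
have [fl flE] : exists f : C -> 'End(C), forall y x, f y x = lbr x y.
  by exists (fun y => amulr y - amull y) => y x; rewrite add_lfunE opp_lfunE !lfunE.
have [fr frE] : exists f : C -> 'End(C), forall x y, f x y = lbr x y.
  by exists (fun x => amull x - amulr x) => x y; rewrite add_lfunE opp_lfunE !lfunE.
move=> x y x2 y2; rewrite -flE; apply: (c2P) x2 => u v; rewrite flE -frE.
apply: (c2P) y2 => w z; rewrite frE.
have -> : forall a b c : C, lbr a (lbr b c) = lbr (lbr a b) c + lbr b (lbr a c).
  move=> a b c; rewrite /lbr !(mulrDl, mulrDr, mulNr, mulrN) !mulrA.
  move: (a * b * c) (b * a * c) (c * a * b) (c * b * a) => x1 x2 x3 x4.
  move: (a * c * b) (b * c * a) => x5 x6; rewrite ?(opprD, opprK, addrA).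
  by rewrite [RHS](ACl (1*7*6*4*(5*2)*(8*3)))%AC /= !subrr !addr0.
by rewrite !act rpredD ?lbr_cliff2.
Qed.

End CliffordDegreeTwo.

Section G2.
Variables (k : fieldType) (O : octonion_algebra k) (C : falgType k).
Variables (iota : {linear subvs_of (octIm O) -> C}).
Variable rho : {linear C -> 'End(O)}.

Definition extends_left_mul : Prop :=
  [/\ rho 1 = \1%VF, forall x y, rho (x * y) = (rho x \o rho y)%VF
    & forall u x, rho (iota u) x = omul (vsval u) x].

(* Membership is spelled out in memv_g2. *)
Definition g2 : {vspace C} :=
  (cliff2 iota :&: lker (linfun (fun x : C => rho x (oone O))))%VS.

Lemma memv_g2 x : (x \in g2) = (x \in cliff2 iota) && (rho x (oone O) == 0).
Proof.
have lin : linear (fun x : C => rho x (oone O)).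
  by move=> a y z /=; rewrite linearP add_lfunE scale_lfunE.
pose f := GRing.isLinear.Build _ _ _ _ (fun x : C => rho x (oone O)) lin.
pose F : {linear C -> O} := HB.pack (fun x : C => rho x (oone O)) f.
by rewrite memv_cap memv_ker (lfunE F).
Qed.

(* vsproj and linfun only repackage maps here: see vsval_g2_br and
   vsval_g2_rep. *)
Definition g2_br (x y : subvs_of g2) : subvs_of g2 :=
  vsproj g2 (lbr (vsval x) (vsval y)).

Definition g2_rep (x : subvs_of g2) : 'End(subvs_of (octIm O)) :=
  linfun (fun v => vsproj (octIm O) (rho (vsval x) (vsval v))).

Definition g2_form (x y : subvs_of g2) : k :=
  - (3^-1 * endo_trace (g2_rep x \o g2_rep y)%VF).

Hypothesis hC : is_clifford (fun u => - onorm (vsval u)) iota.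
Hypothesis hrho : extends_left_mul.

Lemma g2_lbr_closed x y : x \in g2 -> y \in g2 -> lbr x y \in g2.
Proof.
rewrite !memv_g2 => /andP[x2 /eqP x1] /andP[y2 /eqP y1]; apply/andP; split.
  exact: lbr_cliff2_closed hC.1 _ _ x2 y2.
have [_ rM _] := hrho.
by rewrite linearB /= !rM add_lfunE opp_lfunE !comp_lfunE x1 y1 !linear0 addr0.
Qed.

Lemma vsval_g2_br x y : vsval (g2_br x y) = lbr (vsval x) (vsval y).
Proof. by rewrite vsprojK // g2_lbr_closed ?subvsP. Qed.

Lemma rho_cliff2_skew x a b : x \in cliff2 iota ->
  polar (@onorm k O) (rho x a) b + polar (@onorm k O) a (rho x b) = 0.
Proof.
have [_ [bl br]] := onorm_quadratic O.
pose F (x : C) : k^o :=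
  polar (@onorm k O) (rho x a) b + polar (@onorm k O) a (rho x b).
have lin : linear F.
  move=> c y z; rewrite /F linearP /= !add_lfunE !scale_lfunE.
  have /= -> := bl b c (rho y a) (rho z a).
  by have /= -> := br a c (rho y b) (rho z b); rewrite addrACA -mulrDr.
pose f : {linear C -> k^o} := HB.pack F (GRing.isLinear.Build _ _ _ _ F lin).
suff /subvP sub : (cliff2 iota <= lker (linfun f))%VS.
  by move=> /sub; rewrite memv_ker lfunE => /eqP.
apply/sub_cliff2P => u v; rewrite memv_ker lfunE /= /F linearB /=.
have [_ rM rL] := hrho; rewrite !rM !add_lfunE !opp_lfunE !comp_lfunE !rL.
have polB c d e : polar (@onorm k O) (c - d) e
    = polar (@onorm k O) c e - polar (@onorm k O) d e.
  rewrite [c - d]addrC; have /= := bl e (-1) d c.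
  by rewrite scaleN1r mulN1r => ->; rewrite addrC.
rewrite [X in _ + X]polarC !polB ![polar _ _ a]polarC.
by rewrite !(polar_mul_im _ _ (subvsP _)); apply/eqP; ring.
Qed.

Lemma rho_g2_im x u : x \in g2 -> u \in octIm O -> rho x u \in octIm O.
Proof.
rewrite memv_g2 => /andP[x2 /eqP x1] uI.
have := rho_cliff2_skew u (oone O) x2; have [_ [_ br]] := onorm_quadratic O.
have /= := br u (-1) 0 0; rewrite scaler0 addr0 mulN1r addNr x1 => ->.
by rewrite addr0 memv_octIm /oconj => ->; rewrite scale0r add0r.
Qed.

Lemma vsval_g2_rep x v : vsval (g2_rep x v) = rho (vsval x) (vsval v).
Proof.
rewrite (lfunE (vsproj (octIm O) \o rho (vsval x) \o vsval)) /=.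
by rewrite vsprojK // rho_g2_im ?subvsP.
Qed.

End G2.

Lemma exists_extends_left_mul (k : fieldType) (O : octonion_algebra k)
    (C : falgType k) (iota : {linear subvs_of (octIm O) -> C}) :
  is_clifford (fun u => - onorm (vsval u)) iota ->
  exists rho : {linear C -> 'End(O)}, extends_left_mul iota rho.
Proof.
move=> [_ univ].
have pO : (0 < dim O)%N.
  by have := oct_dim O; rewrite dimvf => ->.
pose E0 := lfun_comp_nzRingType pO.
pose E1 : lalgType k := HB.pack 'End(O) E0 (GRing.Lmodule_isLalgebra.Build k E0
  (fun a x y => comp_lfunZl a x y)).
pose E : algType k := HB.pack 'End(O) E1 (GRing.Lalgebra_isAlgebra.Build k E1
  (fun a x y => comp_lfunZr a x y)).
have [mDl mDr] := omul_bilinear O.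
have linm u : linear (@omul k O u) by exact: mDr.
pose m u : {linear O -> O} := HB.pack (@omul k O u) (GRing.isLinear.Build _ _ _ _ _ (linm u)).
pose F (u : subvs_of (octIm O)) : E := linfun (m (vsval u)).
have linF : linear F.
  move=> a u v; apply/lfunP => x; rewrite add_lfunE scale_lfunE !lfunE /=.
  by rewrite (mDl x a (vsval u) (vsval v)).
pose f : {linear subvs_of (octIm O) -> E} := HB.pack F (GRing.isLinear.Build _ _ _ _ F linF).
have [|g [gE _]] := univ E f.
  move=> u; apply/lfunP => x.
  rewrite [LHS]comp_lfunE scale_lfunE id_lfunE !lfunE /= omul_im_sq //.
  exact: subvsP.
have lg : linear (g : C -> 'End(O)) by move=> a x y; exact: (linearP g).
pose r : {linear C -> 'End(O)} := HB.pack (g : C -> 'End(O)) (GRing.isLinear.Build _ _ _ _ _ lg).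
exists r; split=> [|x y|u x].
- exact: (rmorph1 g).
- exact: (rmorphM g).
- by rewrite /= gE lfunE.
Qed.

(* Main.v *)
From HB Require Import structures.
From mathcomp Require Import all_boot all_order all_algebra all_field.
From mathcomp Require Import ring.
Require Import Defs.
Import GRing.Theory.
Local Open Scope ring_scope.

Set Implicit Arguments.
Unset Strict Implicit.
Unset Printing Implicit Defensive.

(** Write V for the imaginary octonions, B for the form on V and [u, v] for the
    commutator uv - vu, which is again imaginary. The map x |-> [x, -] sends the
    degree-two part C2 of the Clifford algebra isomorphically onto so(V, B), and
    an inverse is, up to the factor -8, the contraction
      so_lift A = sum_i [iota (A e_i), iota d_i]
    over a basis e and its dual basis d: see [cliff2_ad] and [lbr_so_lift].
    An element x of C2 with rho(x)(1) = 0 acts on V both through rho and through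
    the commutator in the Clifford algebra, and the two actions coincide
    ([rho_ad]). As rho(so_lift A)(1) = sum_i [A e_i, d_i], the Lie algebra g is
    thereby the set of skew A with sum_i [A e_i, d_i] = 0
    ([rep_inj], [rep_imcomm0], [rep_lift]).

    The octonions enter only through the skewness of w |-> [u, w] and
      [[u, v], v] = 4 (B(u,v) v - B(v,v) u),
    which is [imcomm_imcomm]. Set
      M(u,v) w = 3/2 (B(u,w) v - B(v,w) u) - 1/8 [[u, v], w].
    The contraction sum_i [A e_i, d_i] of the first term is -3 [u, v], and that
    of the second is 3 [u, v] because V has dimension 7; so M(u,v) lies in g
    ([moment_endo_imcomm0]). For x in g the trace of x o M(u,v) is -3 B(xu, v):
    the rank-one operators of the first term give this, and w |-> [a, w] is
    trace-orthogonal to g, pairing with x to B(sum_i [x e_i, d_i], a) = 0.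
    Hence M(u,v) is the value at (u, v) of the moment map for -1/3 Tr
    ([g2_form_moment]). This identity also yields the nondegeneracy of the trace
    form on g: if x is orthogonal to g then B(xu, v) = 0 for all u, v, so x acts
    as zero on V, so x = 0. The special orthogonal identity is then the
    polarisation of [imcomm_imcomm] ([moment_endo_special]). *)

(** * Bilinear maps *)

Section BilinearMaps.
Variables (k : fieldType) (U V W : lmodType k) (f : U -> V -> W).
Hypothesis hf : bilinear_map f.

Let linl v : {linear U -> W} :=
  HB.pack (f^~ v) (GRing.isLinear.Build _ _ _ _ (f^~ v) (hf.1 v)).
Let linr u : {linear V -> W} :=
  HB.pack (f u) (GRing.isLinear.Build _ _ _ _ (f u) (hf.2 u)).

Lemma bilinDl u u' v : f (u + u') v = f u v + f u' v.
Proof. exact: (linearD (linl v)). Qed.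
Lemma bilinDr u v v' : f u (v + v') = f u v + f u v'.
Proof. exact: (linearD (linr u)). Qed.
Lemma bilinNl u v : f (- u) v = - f u v.
Proof. exact: (linearN (linl v)). Qed.
Lemma bilinNr u v : f u (- v) = - f u v.
Proof. exact: (linearN (linr u)). Qed.
Lemma bilinBl u u' v : f (u - u') v = f u v - f u' v.
Proof. by rewrite bilinDl bilinNl. Qed.
Lemma bilinBr u v v' : f u (v - v') = f u v - f u v'.
Proof. by rewrite bilinDr bilinNr. Qed.
Lemma bilinZl a u v : f (a *: u) v = a *: f u v.
Proof. exact: (linearZ_LR (linl v)). Qed.
Lemma bilinZr a u v : f u (a *: v) = a *: f u v.
Proof. exact: (linearZ_LR (linr u)). Qed.
Lemma bilin0l v : f 0 v = 0.
Proof. exact: (linear0 (linl v)). Qed.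
Lemma bilin_suml I (r : seq I) P (F : I -> U) v :
  f (\sum_(i <- r | P i) F i) v = \sum_(i <- r | P i) f (F i) v.
Proof. exact: (linear_sum (linl v)). Qed.
Lemma bilin_sumr I (r : seq I) P u (F : I -> V) :
  f u (\sum_(i <- r | P i) F i) = \sum_(i <- r | P i) f u (F i).
Proof. exact: (linear_sum (linr u)). Qed.

End BilinearMaps.

(** Lets the lemmas on bilinear maps apply to forms, scaling in [k^o] being
    multiplication. *)
Lemma bilinear_form_map (k : fieldType) (V : lmodType k) (b : V -> V -> k) :
  bilinear_form b -> bilinear_map (b : V -> V -> k^o).
Proof. by []. Qed.

Section BilinearForms.
Variables (k : fieldType) (V : lmodType k) (b : V -> V -> k).
Hypothesis hb : bilinear_form b.

Let hb' := bilinear_form_map hb.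

Lemma formDl u u' v : b (u + u') v = b u v + b u' v.
Proof. exact: (bilinDl hb'). Qed.
Lemma formDr u v v' : b u (v + v') = b u v + b u v'.
Proof. exact: (bilinDr hb'). Qed.
Lemma formNl u v : b (- u) v = - b u v.
Proof. exact: (bilinNl hb'). Qed.
Lemma formNr u v : b u (- v) = - b u v.
Proof. exact: (bilinNr hb'). Qed.
Lemma formBl u u' v : b (u - u') v = b u v - b u' v.
Proof. exact: (bilinBl hb'). Qed.
Lemma formBr u v v' : b u (v - v') = b u v - b u v'.
Proof. exact: (bilinBr hb'). Qed.
Lemma formZl a u v : b (a *: u) v = a * b u v.
Proof. exact: (bilinZl hb'). Qed.
Lemma formZr a u v : b u (a *: v) = a * b u v.
Proof. exact: (bilinZr hb'). Qed.
Lemma form0l v : b 0 v = 0.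
Proof. exact: (bilin0l hb'). Qed.
Lemma form_suml I (r : seq I) P (F : I -> V) v :
  b (\sum_(i <- r | P i) F i) v = \sum_(i <- r | P i) b (F i) v.
Proof. exact: (bilin_suml hb'). Qed.
Lemma form_sumr I (r : seq I) P u (F : I -> V) :
  b u (\sum_(i <- r | P i) F i) = \sum_(i <- r | P i) b u (F i).
Proof. exact: (bilin_sumr hb'). Qed.

End BilinearForms.

(** Turns an identity between vectors into one between scalars, where [ring]
    applies. *)
Lemma form_ext (k : fieldType) (V : lmodType k) (b : V -> V -> k) u v :
  bilinear_form b -> nondegenerate b -> (forall w, b u w = b v w) -> u = v.
Proof.
move=> hb bnd uv; apply/eqP; rewrite -subr_eq0; apply/eqP/bnd => w.
by rewrite (formBl hb) uv subrr.
Qed.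

Lemma linfun_linearE (k : fieldType) (U W : vectType k) (f : U -> W) :
  linear f -> linfun f =1 f.
Proof.
move=> lf; pose F : {linear U -> W} :=
  HB.pack f (GRing.isLinear.Build _ _ _ _ f lf).
exact: (lfunE F).
Qed.

(** * Dual bases and traces *)

Section Wedge.
Variables (k : fieldType) (V : vectType k) (b : V -> V -> k).
Hypotheses (hb : bilinear_form b) (bC : symmetric_form b).

(** These operators span the skew endomorphisms; up to the factor 4 they are
    the adjoint actions of the commutators in the Clifford algebra. *)
Definition wedge (u v : V) : 'End(V) :=
  linfun (fun w => b u w *: v - b v w *: u).

Lemma wedgeE u v w : wedge u v w = b u w *: v - b v w *: u.
Proof.
apply: (linfun_linearE (f := fun w => b u w *: v - b v w *: u)) => a x y.
rewrite !(formDr hb) !(formZr hb) !scalerDl opprD addrACA.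
by rewrite scalerBr !scalerA.
Qed.

Lemma wedge_skew u v x y : b (wedge u v x) y = - b x (wedge u v y).
Proof.
rewrite !wedgeE (formBl hb) (formBr hb) !(formZl hb) !(formZr hb).
rewrite (bC x v) (bC x u); ring.
Qed.

End Wedge.

Section DualBases.
Variables (k : fieldType) (V : vectType k) (b : V -> V -> k).
Hypotheses (hb : bilinear_form b) (bC : symmetric_form b).
Hypothesis bnd : nondegenerate b.

Let n := \dim {:V}.

Definition basis_vec (i : 'I_n) : V := (vbasis {:V})`_i.

Definition gram : 'M[k]_n := \matrix_(i, j) b (basis_vec i) (basis_vec j).

Definition dual_vec (i : 'I_n) : V := \sum_j invmx gram i j *: basis_vec j.

Lemma basis_vec_expand v : v = \sum_i coord (vbasis {:V}) i v *: basis_vec i.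
Proof. exact: coord_vbasis (memvf v). Qed.

Lemma gram_unit : gram \in unitmx.
Proof.
rewrite -row_free_unit; apply: inj_row_free => r rG; apply/rowP => i.
rewrite mxE; have /freeP := basis_free (vbasisP {:V}); apply.
apply: bnd => w; rewrite [w]basis_vec_expand (form_sumr hb) big1 // => j _.
have /rowP /(_ j) := rG; rewrite !mxE (formZr hb) (form_suml hb) => e.
suff -> : \sum_l b (r 0 l *: (vbasis {:V})`_l) (basis_vec j) = 0.
  by rewrite mulr0.
by rewrite -[RHS]e; apply: eq_bigr => l _; rewrite (formZl hb) mxE.
Qed.

Lemma dual_vec_basis_vec i j : b (dual_vec i) (basis_vec j) = (i == j)%:R.
Proof.
have /matrixP /(_ i j) := mulVmx gram_unit; rewrite !mxE => <-.
by rewrite (form_suml hb); apply: eq_bigr => l _; rewrite (formZl hb) mxE.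
Qed.

Lemma coord_dual_vec i v : coord (vbasis {:V}) i v = b (dual_vec i) v.
Proof.
rewrite [v in RHS]basis_vec_expand (form_sumr hb) (bigD1 i) //= big1 => [|j ji].
  by rewrite (formZr hb) dual_vec_basis_vec eqxx mulr1 addr0.
by rewrite (formZr hb) dual_vec_basis_vec eq_sym (negPf ji) mulr0.
Qed.

Lemma sum_dual_basis v : \sum_i b (dual_vec i) v *: basis_vec i = v.
Proof.
rewrite [RHS]basis_vec_expand.
by under [RHS]eq_bigr do rewrite coord_dual_vec.
Qed.

Lemma sum_basis_dual v : \sum_i b (basis_vec i) v *: dual_vec i = v.
Proof.
apply: (form_ext hb bnd) => w.
rewrite (form_suml hb) -[in RHS](sum_dual_basis w) (form_sumr hb).
by apply: eq_bigr => i _; rewrite (formZl hb) (formZr hb) (bC v) mulrC.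
Qed.

(** The tensor sum_i e_i (x) d_i is symmetric because [b] is. *)
Lemma sum_dual_swap (W : lmodType k) (f : V -> V -> W) :
  bilinear_map f ->
  \sum_i f (basis_vec i) (dual_vec i) = \sum_i f (dual_vec i) (basis_vec i).
Proof.
move=> hf; have e i : f (basis_vec i) (dual_vec i)
    = \sum_j b (dual_vec j) (dual_vec i) *: f (basis_vec i) (basis_vec j).
  rewrite -[in LHS](sum_dual_basis (dual_vec i)) (bilin_sumr hf).
  by apply: eq_bigr => j _; rewrite (bilinZr hf).
under eq_bigr do rewrite e; rewrite exchange_big; apply: eq_bigr => j _.
rewrite -[in RHS](sum_dual_basis (dual_vec j)) (bilin_suml hf).
by apply: eq_bigr => i _; rewrite (bilinZl hf) bC.
Qed.

(** For f the commutator of the Clifford algebra this inverts the map from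
    degree two to so(V); for f the commutator of octonions it gives the
    contraction that vanishes on derivations. *)
Lemma sum_dual_wedge (W : lmodType k) (f : V -> V -> W) u v :
  bilinear_map f ->
  \sum_i f (wedge b u v (basis_vec i)) (dual_vec i) = f v u - f u v.
Proof.
move=> hf.
have rank1 w w' : \sum_i f (b w (basis_vec i) *: w') (dual_vec i) = f w' w.
  rewrite -[in RHS](sum_basis_dual w) (bilin_sumr hf).
  by apply: eq_bigr => i _; rewrite (bilinZl hf) (bilinZr hf) bC.
under eq_bigr do rewrite (wedgeE hb) (bilinBl hf).
by rewrite sumrB !rank1.
Qed.

Lemma endo_traceE f : endo_trace f = \sum_i b (dual_vec i) (f (basis_vec i)).
Proof.
rewrite /endo_trace /mxtrace; apply: eq_bigr => i _.
rewrite -coord_dual_vec /passmx.mxof mxE /=.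
by rewrite -(passmx.rVofE (vbasisP {:V})) passmx.rVofK ?vbasisP // mxE.
Qed.

Lemma sum_dual_form : \sum_i b (dual_vec i) (basis_vec i) = n%:R.
Proof.
under eq_bigr do rewrite dual_vec_basis_vec eqxx.
by rewrite sumr_const card_ord.
Qed.

End DualBases.

Lemma endo_traceC (k : fieldType) (V : vectType k) (f g : 'End(V)) :
  endo_trace (f \o g)%VF = endo_trace (g \o f)%VF.
Proof.
by rewrite /endo_trace !(passmx.mxof_comp _ _ (vbasisP {:V})) mxtrace_mulC.
Qed.

Lemma endo_trace_linear (k : fieldType) (V : vectType k) :
  scalar (@endo_trace k V).
Proof.
by move=> a f g; rewrite /endo_trace passmx.mxof_linear mxtraceD mxtraceZ.
Qed.

(** * The commutator on the imaginary octonions *)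

Section SubspaceInclusion.
Variables (k : fieldType) (W : vectType k) (U : {vspace W}).
Implicit Types x y : subvs_of U.

Lemma vsvalP a x y : vsval (a *: x + y) = a *: vsval x + vsval y.
Proof. exact: linearP. Qed.
Lemma vsvalD x y : vsval (x + y) = vsval x + vsval y.
Proof. exact: linearD. Qed.
Lemma vsvalZ a x : vsval (a *: x) = a *: vsval x.
Proof. exact: linearZ. Qed.
Lemma vsvalN x : vsval (- x) = - vsval x.
Proof. exact: linearN. Qed.
Lemma vsvalB x y : vsval (x - y) = vsval x - vsval y.
Proof. exact: linearB. Qed.

End SubspaceInclusion.

Section ImaginaryOctonions.
Variables (k : fieldType) (O : octonion_algebra k).
Hypothesis k2 : 2%N \notin [pchar k].

Local Notation q := (@onorm k O).
Local Notation p := (polar q).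
Local Notation V := (subvs_of (octIm O)).
Local Notation B := (@imform k O).
Local Notation "x ** y" := (omul x y) (at level 40).

Let hM := omul_bilinear O.
Let hp : bilinear_form p := (onorm_quadratic O).2.

Lemma two_neq0 : 2 != 0 :> k.
Proof. by move: k2; rewrite inE. Qed.

Lemma memv_octImE (u : O) : (u \in octIm O) = (p u (oone O) == 0).
Proof.
rewrite memv_octIm /oconj -subr_eq0 opprK subrK scaler_eq0.
by rewrite (negPf (oone_neq0 O)) orbF.
Qed.

(** Right multiplication by an imaginary u is skew: expand the polar
    form of x(u + 1) and y(u + 1), using that u is orthogonal to 1. *)
Lemma polar_mulr_im (u x y : O) : u \in octIm O ->
  p (x ** u) y = - p x (y ** u).
Proof.
move=> /polar_im1 u1.
have same a b c : p (b ** a) (c ** a) = p b c * q a.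
  by rewrite /polar -(bilinDl hM) !onormM !mulrBl.
have q1 : q (u + oone O) = q u + q (oone O).
  by apply/eqP; rewrite -subr_eq0 opprD addrA -/(polar q u (oone O)) u1.
have p1 : p x y = p x y * q (oone O) by rewrite -same !omul1r.
have := same (u + oone O) x y; rewrite !(bilinDr hM) !omul1r.
rewrite !(formDl hp) !(formDr hp) same q1 mulrDr -p1 => e.
apply/eqP; rewrite -subr_eq0 opprK; apply/eqP.
rewrite -[RHS](subrr (p x y * q u + p x y)) -[in X in _ = X - _]e; ring.
Qed.

Lemma omul_im_sqr (u x : O) : u \in octIm O -> (x ** u) ** u = - q u *: x.
Proof.
move=> uI; apply/eqP; rewrite -subr_eq0 scaleNr opprK; apply/eqP.
apply: (@onorm_nondegenerate k O) => y.
rewrite (formDl hp) (formZl hp) (polar_mulr_im _ _ uI).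
by rewrite /polar -(bilinDl hM) !onormM; ring.
Qed.

(** Polarises u^2 = -q(u) 1. *)
Lemma omul_im_anti (u v : O) : u \in octIm O -> v \in octIm O ->
  v ** u = - p u v *: oone O - u ** v.
Proof.
move=> uI vI.
have sq w : w \in octIm O -> w ** w = - q w *: oone O.
  by move=> /(omul_im_sq (oone O)); rewrite !omul1r.
have := sq (u + v) (memvD uI vI).
rewrite (bilinDl hM) !(bilinDr hM) !sq // => e.
apply: (form_ext hp (@onorm_nondegenerate k O)) => w.
have := congr1 (p^~ w) e.
rewrite !(formBl hp, formDl hp, formZl hp) => e1.
rewrite -[RHS]addr0 -(subrr (- q (u + v) * p (oone O) w)).
by rewrite -[in X in _ + (X - _)]e1 /(p u v); ring.
Qed.

Definition imcomm (u v : V) : V :=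
  vsproj (octIm O) (vsval u ** vsval v - vsval v ** vsval u).

Lemma vsval_imcomm u v :
  vsval (imcomm u v) = vsval u ** vsval v - vsval v ** vsval u.
Proof.
rewrite vsprojK // memv_octImE (formBl hp).
rewrite (polar_mul_im _ _ (subvsP u)) (polar_mulr_im _ _ (subvsP u)).
by rewrite omul1l omul1r subrr.
Qed.

Lemma imcomm_bilinear : bilinear_map imcomm.
Proof.
split=> [v|u] a x y; apply: subvs_inj;
  rewrite vsvalP !vsval_imcomm vsvalP scalerBr;
  by rewrite (bilinDl hM) (bilinDr hM) (bilinZl hM) (bilinZr hM) opprD addrACA.
Qed.

Lemma imcommC u v : imcomm v u = - imcomm u v.
Proof. by apply: subvs_inj; rewrite vsvalN !vsval_imcomm opprB. Qed.

Lemma imform_bilinear : bilinear_form B.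
Proof.
split=> [v|u] a x y; rewrite /imform /oform vsvalP.
  by rewrite (formDl hp) (formZl hp); ring.
by rewrite (formDr hp) (formZr hp); ring.
Qed.

Lemma imformC : symmetric_form B.
Proof. by move=> u v; rewrite /imform /oform polarC. Qed.

Lemma polar_imform (u v : V) : p (vsval u) (vsval v) = 2 * B u v.
Proof. by rewrite /imform /oform mulrA divff ?two_neq0 // mul1r. Qed.

Lemma imcomm_skew u v w : B (imcomm u v) w = - B v (imcomm u w).
Proof.
rewrite /imform /oform !vsval_imcomm (formBl hp) (formBr hp).
rewrite (polar_mul_im _ _ (subvsP u)) (polar_mulr_im _ _ (subvsP u)).
ring.
Qed.

Lemma polar11 : p (oone O) (oone O) = 2 * q (oone O).
Proof.
have [qZ _] := onorm_quadratic O.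
by rewrite /polar -mulr2n -scaler_nat qZ; ring.
Qed.

Lemma onorm1 : q (oone O) = 1.
Proof.
have : q (oone O) * (q (oone O) - 1) = 0.
  by rewrite mulrBr mulr1 -onormM omul1l subrr.
move/eqP; rewrite mulf_eq0 subr_eq0 => /orP[/eqP q0|/eqP //].
have/negP[] := oone_neq0 O; apply/eqP/(@onorm_nondegenerate k O) => v.
have e w : q w = 0 by rewrite -[w]omul1l onormM q0 mul0r.
by rewrite /polar !e !subr0.
Qed.

Lemma oct_decomp (x : O) : exists2 u, u \in octIm O &
  x = (2^-1 * p x (oone O)) *: oone O + u.
Proof.
exists (x - (2^-1 * p x (oone O)) *: oone O); last by rewrite addrC subrK.
rewrite memv_octImE (formBl hp) (formZl hp) polar11 onorm1.
by apply/eqP; field; exact: two_neq0.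
Qed.

Lemma imform_nondegenerate : nondegenerate B.
Proof.
move=> u hu; apply: subvs_inj => /=; apply: (@onorm_nondegenerate k O) => x.
have [v vI ->] := oct_decomp x.
rewrite (formDr hp) (formZr hp) (polar_im1 (subvsP u)) mulr0 add0r.
by rewrite -(vsprojK vI) polar_imform hu mulr0.
Qed.

(** The octonions of the form conj x + x are the scalars, so the kernel [octIm]
    of this map has codimension one. *)
Lemma dim_octIm : \dim {:V} = 7.
Proof.
have -> : \dim {:V} = \dim (octIm O) by rewrite !dimvf /=.
have -> : octIm O = (octIm O :&: {:O})%VS by rewrite capvf.
pose f := (linfun (@oconj k O) + \1)%VF.
have E x : f x = p x (oone O) *: oone O.
  by rewrite add_lfunE id_lfunE lfunE /= subrK.
have := limg_ker_dim f {:O}; rewrite oct_dim capvC -/(octIm O).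
suff -> : limg f = <[oone O]>%VS by rewrite dim_vline oone_neq0 addn1 => -[].
apply/eqP; rewrite eqEsubv; apply/andP; split; apply/subvP => x.
  by move=> /memv_imgP[y _ ->]; rewrite E memvZ // memv_line.
move=> /vlineP[a ->]; apply/memv_imgP; exists ((2^-1 * a) *: oone O).
  exact: memvf.
rewrite E (formZl hp) polar11 onorm1; congr (_ *: _).
by field; exact: two_neq0.
Qed.

(** Alternativity gives (uv)v and v(vu); the other two terms (vu)v and v(uv)
    reduce to them by anticommuting u past v ([omul_im_anti]). *)
Lemma imcomm_imcomm u v :
  imcomm (imcomm u v) v = 4 *: (B u v *: v - B v v *: u).
Proof.
apply: subvs_inj; rewrite vsvalZ vsvalB !vsvalZ !vsval_imcomm.
have uI := subvsP u; have vI := subvsP v.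
rewrite (bilinBl hM) (bilinBr hM).
have -> : (vsval v ** vsval u) ** vsval v
    = - p (vsval u) (vsval v) *: vsval v - (vsval u ** vsval v) ** vsval v.
  by rewrite (omul_im_anti uI vI) (bilinBl hM) (bilinZl hM) omul1l.
have -> : vsval v ** (vsval u ** vsval v)
    = - p (vsval u) (vsval v) *: vsval v - vsval v ** (vsval v ** vsval u).
  by rewrite (omul_im_anti vI uI) polarC (bilinBr hM) (bilinZr hM) omul1r.
rewrite (omul_im_sqr _ vI) (omul_im_sq _ vI) -oform_diag //.
apply: (form_ext hp (@onorm_nondegenerate k O)) => w.
rewrite !(formBl hp, formDl hp, formZl hp, formNl hp).
by rewrite polar_imform /imform; ring.
Qed.
End ImaginaryOctonions.

(** * Degree two of a Clifford algebra and skew endomorphisms *)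

Lemma lbr_bilinear (k : fieldType) (C : falgType k) : bilinear_map (@lbr k C).
Proof.
split=> [v|u] a x y; rewrite /lbr.
  by rewrite mulrDl mulrDr -scalerAl -scalerAr scalerBr opprD addrACA.
by rewrite mulrDl mulrDr -scalerAl -scalerAr scalerBr opprD addrACA.
Qed.

Lemma lbr_jacobi (k : fieldType) (C : falgType k) (x y z : C) :
  lbr x (lbr y z) + lbr y (lbr z x) + lbr z (lbr x y) = 0.
Proof.
rewrite /lbr !(mulrBl, mulrBr) !mulrA.
move: (x * y * z) (y * x * z) (z * x * y) (z * y * x) => x1 x2 x3 x4.
move: (x * z * y) (y * z * x) => x5 x6; rewrite !(opprB, addrA).
(* The twelve monomials of the expansion, matched in cancelling pairs. *)
rewrite [LHS](ACl (1*12*(7*2)*(3*10)*(5*4)*(11*6)*(9*8)))%AC /=.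
by rewrite !subrr !addr0.
Qed.

Section CliffordSo.
Variables (k : fieldType) (V : vectType k) (C : falgType k).
Variables (b : V -> V -> k) (iota : {linear V -> C}).
Hypotheses (hb : bilinear_form b) (bC : symmetric_form b).
Hypothesis bnd : nondegenerate b.
Hypothesis iota_anti : forall u v,
  iota u * iota v + iota v * iota u = (- (2 * b u v))%:A.

Lemma cliff2_ind (P : C -> Prop) :
  P 0 -> (forall a x y, P x -> P y -> P (a *: x + y)) ->
  (forall u v, P (lbr (iota u) (iota v))) ->
  forall x, x \in cliff2 iota -> P x.
Proof.
move=> P0 PD Pl x; rewrite /cliff2; set X := (X in <<X>>%VS) => Xx.
rewrite (coord_span (X := in_tuple X) Xx).
elim/big_rec: _ => // i y _; apply: PD.
have /allpairsP[[u v] [_ _ ->]] : X`_i \in X by rewrite mem_nth.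
exact: Pl.
Qed.

Let iotaZ a v : iota (a *: v) = a *: iota v. Proof. exact: linearZ. Qed.
Let iotaB u v : iota (u - v) = iota u - iota v. Proof. exact: linearB. Qed.

Let lbr_iota_bilinear : bilinear_map (fun u v => lbr (iota u) (iota v)).
Proof.
have hl := lbr_bilinear C.
split=> [v|u] a x y; rewrite linearP.
  by rewrite (bilinDl hl) (bilinZl hl).
by rewrite (bilinDr hl) (bilinZr hl).
Qed.

(** Degree two acts on V by skew endomorphisms: this is the isomorphism of the
    degree-two part with so(V). *)
Lemma lbr_lbr u v w :
  lbr (lbr (iota u) (iota v)) (iota w) = iota (4 *: wedge b u v w).
Proof.
have comm r v' (x := iota v') : (4 * r) *: x
    = - (x * (- (2 * r))%:A + (- (2 * r))%:A * x).
  rewrite -scalerAl -scalerAr mul1r mulr1 -scalerDl -scaleNr.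
  by congr (_ *: _); ring.
rewrite (wedgeE hb) scalerBr !scalerA iotaB !iotaZ !comm.
rewrite -!iota_anti /lbr !(mulrDl, mulrDr, mulNr, mulrN) !mulrA.
move: (iota u) (iota v) (iota w) => x y z.
move: (x * y * z) (y * x * z) (z * x * y) (z * y * x) => x1 x2 x3 x4.
move: (x * z * y) (y * z * x) => x5 x6; rewrite ?(opprD, opprK, addrA).
(* The four surviving monomials, then two cancelling pairs. *)
by rewrite [RHS](ACl (5*1*4*8*(6*3)*(7*2)))%AC /= !subrr !addr0.
Qed.

Local Notation e := (@basis_vec k V).
Local Notation d := (dual_vec b).

(** The inverse of the adjoint action on V, up to the factor -8. *)
Definition so_lift (A : 'End(V)) : C :=
  \sum_i lbr (iota (A (e i))) (iota (d i)).

Lemma so_lift_cliff2 A : so_lift A \in cliff2 iota.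
Proof. by apply: rpred_sum => i _; apply: lbr_cliff2. Qed.

Lemma so_lift_linear : linear so_lift.
Proof.
move=> a x y; rewrite /so_lift scaler_sumr -big_split; apply: eq_bigr => i _.
rewrite add_lfunE scale_lfunE linearP.
by rewrite (bilinDl (lbr_bilinear C)) (bilinZl (lbr_bilinear C)).
Qed.

Lemma so_liftZ a A : so_lift (a *: A) = a *: so_lift A.
Proof.
rewrite /so_lift scaler_sumr; apply: eq_bigr => i _.
by rewrite scale_lfunE iotaZ (bilinZl (lbr_bilinear C)).
Qed.

Lemma so_lift_wedge u v :
  so_lift (wedge b u v) = (- 2) *: lbr (iota u) (iota v).
Proof.
rewrite /so_lift (sum_dual_wedge hb bC bnd u v lbr_iota_bilinear).
have -> : lbr (iota v) (iota u) = - lbr (iota u) (iota v).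
  by rewrite /lbr opprB.
by rewrite -opprD scaleNr scaler_nat mulr2n.
Qed.

Lemma lbr_so_lift (A : 'End(V)) w : (forall x y, b (A x) y = - b x (A y)) ->
  lbr (so_lift A) (iota w) = iota (- 8 *: A w).
Proof.
move=> Ask; rewrite (bilin_suml (lbr_bilinear C)).
under eq_bigr do rewrite lbr_lbr (wedgeE hb).
rewrite -linear_sum -scaler_sumr sumrB.
have -> : \sum_i b (d i) w *: A (e i) = A w.
  rewrite -[in RHS](sum_dual_basis hb bnd w) linear_sum.
  by apply: eq_bigr => i _; rewrite linearZ.
under eq_bigr do rewrite Ask scaleNr.
rewrite sumrN (sum_basis_dual hb bC bnd).
rewrite -opprD -mulr2n -scaler_nat scalerN -scaleNr scalerA.
by congr (iota (_ *: _)); ring.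
Qed.

(** The adjoint action of x on V determines x. The factor is -8 since
    [lbr (iota u) (iota v)] acts by 4 (u ^ v), whose lift is -2 times 4 times
    that commutator. *)
Lemma cliff2_ad x : x \in cliff2 iota -> exists A : 'End(V),
  (forall w, lbr x (iota w) = iota (A w)) /\ so_lift A = (- 8) *: x.
Proof.
have hl := lbr_bilinear C.
move: x; apply: cliff2_ind => [|a x y [A [Ax Al]] [A' [Ay Al']]|u v].
- exists 0; split=> [w|].
    by rewrite lfunE /= linear0 /lbr mul0r mulr0 subrr.
  rewrite scaler0 /so_lift big1 // => i _.
  by rewrite lfunE /= linear0 /lbr mul0r mulr0 subrr.
- exists (a *: A + A'); split=> [w|].
    by rewrite (bilinDl hl) (bilinZl hl) Ax Ay add_lfunE scale_lfunE linearP.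
  rewrite so_lift_linear Al Al' scalerDr !scalerA; congr (_ *: _ + _); ring.
- exists (4 *: wedge b u v); split=> [w|].
    by rewrite lbr_lbr scale_lfunE.
  by rewrite so_liftZ so_lift_wedge scalerA; congr (_ *: _); ring.
Qed.

End CliffordSo.

(** * The Lie algebra inside the Clifford algebra *)

Section G2.
Variables (k : fieldType).
Hypotheses (k2 : 2%N \notin [pchar k]) (k3 : 3%N \notin [pchar k]).
Variables (O : octonion_algebra k) (C : falgType k).
Local Notation V := (subvs_of (octIm O)).
Variable iota : {linear V -> C}.
Hypothesis hC : is_clifford (fun u => - onorm (vsval u)) iota.
Variable rho : {linear C -> 'End(O)}.
Hypothesis hrho : extends_left_mul iota rho.

Local Notation G := (g2 iota rho).
Local Notation L := (subvs_of G).
Local Notation B := (@imform k O).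
Local Notation br := (@g2_br k O C iota rho).
Local Notation BL := (@g2_form k O C iota rho).
Local Notation rep := (@g2_rep k O C iota rho).
Local Notation e := (@basis_vec k V).
Local Notation d := (dual_vec B).
Local Notation "[ u , v ]" := (imcomm u v).
Local Notation one := (oone O).

Let hB := @imform_bilinear k O.
Let hBC := @imformC k O.
Let hBnd := @imform_nondegenerate k O k2.
Let hcr := @imcomm_bilinear k O.
Let n2 : 2 != 0 :> k := two_neq0 k2.

Lemma three_neq0 : 3 != 0 :> k.
Proof. by move: k3; rewrite inE. Qed.

Lemma iota_anti u v : iota u * iota v + iota v * iota u = (- (2 * B u v))%:A.
Proof.
have [sq _] := hC; have := sq (u + v).
rewrite linearD mulrDl !mulrDr !sq => E.
rewrite -(polar_imform k2) /polar.
have -> : iota u * iota v + iota v * iota u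
    = (- onorm (vsval u))%:A + iota u * iota v
      + (iota v * iota u + (- onorm (vsval v))%:A)
      - (- onorm (vsval u))%:A - (- onorm (vsval v))%:A.
  by rewrite !addrA [RHS](ACl (2*3*(1*5)*(4*6)))%AC /= !subrr !addr0.
by rewrite E -!scalerBl vsvalD; congr (_ *: _); ring.
Qed.

(** Apply [x, iota w] to 1: as x kills 1, only x (w 1) = x w remains. *)
Lemma rho_ad x (A : 'End(V)) w : x \in G ->
  lbr x (iota w) = iota (A w) -> rho x (vsval w) = vsval (A w).
Proof.
rewrite memv_g2 => /andP[_ /eqP x1] /(congr1 (fun y => rho y one)).
have [_ rM rL] := hrho.
rewrite rL omul1r linearB add_lfunE opp_lfunE !rM !comp_lfunE x1 linear0.
by rewrite rL omul1r subr0.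
Qed.

(** Faithfulness of the representation in a precise form: x is recovered from
    its action on V. *)
Lemma so_lift_g2_rep x : so_lift B iota (rep x) = (- 8) *: vsval x.
Proof.
have xG := subvsP x; have := xG; rewrite memv_g2 => /andP[x2 _].
have [A [Ax <-]] := cliff2_ad hB hBC hBnd iota_anti x2.
congr so_lift; apply/lfunP => w; apply: subvs_inj.
by rewrite (vsval_g2_rep hrho) (rho_ad xG (Ax w)).
Qed.

Lemma rep_linear : linear rep.
Proof.
move=> a x y; apply/lfunP => v; apply: subvs_inj.
rewrite add_lfunE scale_lfunE vsvalP !(vsval_g2_rep hrho) vsvalP.
by rewrite linearP add_lfunE scale_lfunE.
Qed.

Lemma opp8_neq0 : - 8 != 0 :> k.
Proof. by rewrite oppr_eq0 (_ : 8 = 2 ^+ 3) ?expf_neq0 //; ring. Qed.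

Lemma rep_inj : injective rep.
Proof.
move=> x y xy; apply: subvs_inj; apply: (scalerI opp8_neq0).
by rewrite -!so_lift_g2_rep xy.
Qed.

Lemma rho_so_lift1 A :
  rho (so_lift B iota A) one = vsval (\sum_i [A (e i), d i]).
Proof.
have [_ rM rL] := hrho.
rewrite /so_lift linear_sum sum_lfunE linear_sum; apply: eq_bigr => i _ /=.
rewrite vsval_imcomm linearB add_lfunE opp_lfunE /= !rM !comp_lfunE !rL.
by rewrite !omul1r.
Qed.

(** The condition rho(x)(1) = 0 read on endomorphisms of V. *)
Lemma rep_imcomm0 x : \sum_i [rep x (e i), d i] = 0.
Proof.
apply: subvs_inj; rewrite -rho_so_lift1 so_lift_g2_rep.
have := subvsP x; rewrite memv_g2 => /andP[_ /eqP x1].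
by rewrite linearZ scale_lfunE x1 scaler0 linear0.
Qed.

(** Meaningful for skew A whose lift kills 1, see [rep_lift]; otherwise the
    projection onto the Lie algebra is applied to an element outside it. *)
Definition g2_lift (A : 'End(V)) : L := vsproj G ((- 8)^-1 *: so_lift B iota A).

(** Conversely every skew endomorphism with vanishing contraction comes from the
    Lie algebra. *)
Lemma rep_lift (A : 'End(V)) :
  (forall x y, B (A x) y = - B x (A y)) -> \sum_i [A (e i), d i] = 0 ->
  rep (g2_lift A) = A.
Proof.
move=> Ask A0; have yG : (- 8)^-1 *: so_lift B iota A \in G.
  rewrite memv_g2 memvZ ?so_lift_cliff2 //= linearZ scale_lfunE.
  by rewrite rho_so_lift1 A0 !linear0 eqxx.
apply/lfunP => w; apply: subvs_inj.
rewrite (vsval_g2_rep hrho) vsprojK //; apply: rho_ad => //.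
rewrite (bilinZl (lbr_bilinear C)) (lbr_so_lift hB hBC hBnd iota_anti) //.
by rewrite linearZ scalerA mulVf ?opp8_neq0 // scale1r.
Qed.

Lemma rep_skew x v w : B (rep x v) w = - B v (rep x w).
Proof.
apply/eqP; rewrite -addr_eq0 /imform /oform !(vsval_g2_rep hrho) -mulrDr.
have := subvsP x; rewrite memv_g2 => /andP[x2 _].
by rewrite (rho_cliff2_skew hrho) // mulr0.
Qed.

Lemma rep_br x y v : rep (br x y) v = rep x (rep y v) - rep y (rep x v).
Proof.
have [_ rM _] := hrho.
apply: subvs_inj; rewrite vsvalB !(vsval_g2_rep hrho) (vsval_g2_br hC hrho).
by rewrite linearB add_lfunE opp_lfunE /= !rM !comp_lfunE.
Qed.

Definition im_ad (a : V) : 'End(V) := linfun (imcomm a).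

Lemma im_adE a v : im_ad a v = [a, v].
Proof. exact: (linfun_linearE (hcr.2 a)). Qed.

(** A multiple of the trace-orthogonal projection of the wedge of u and v onto
    the Lie algebra; 3/2 makes the trace form reproduce B (see
    [trace_rep_moment]), and 1/8 makes the contraction vanish (see
    [moment_endo_imcomm0]). *)
Definition moment_endo u v : 'End(V) :=
  (3 / 2) *: wedge B u v - 8^-1 *: im_ad [u, v].

Lemma moment_endoE u v w : moment_endo u v w =
  (3 / 2) *: (B u w *: v - B v w *: u) - 8^-1 *: [[u, v], w].
Proof.
by rewrite add_lfunE opp_lfunE !scale_lfunE (wedgeE hB) im_adE.
Qed.

Lemma moment_endo_skew u v x y :
  B (moment_endo u v x) y = - B x (moment_endo u v y).
Proof.
rewrite !add_lfunE !opp_lfunE !scale_lfunE (formBl hB) (formBr hB).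
rewrite !(formZl hB) !(formZr hB) (wedge_skew hB hBC) !im_adE imcomm_skew.
ring.
Qed.

Lemma sum_imcomm_wedge u v : \sum_i [wedge B u v (e i), d i] = - 2 *: [u, v].
Proof.
rewrite (sum_dual_wedge hB hBC hBnd u v hcr).
by rewrite imcommC scaleNr scaler_nat mulr2n opprD.
Qed.

(** Polarises [imcomm_imcomm] in v. *)
Lemma imcomm_polar a u v : [[a, u], v] + [[a, v], u] =
  4 *: (B a u *: v + B a v *: u - (2 * B u v) *: a).
Proof.
have := imcomm_imcomm k2 a (u + v).
rewrite !(bilinDr hcr) !(bilinDl hcr) !(imcomm_imcomm k2) => E.
apply: (form_ext hB hBnd) => w; have := congr1 (B^~ w) E.
rewrite !(formBl hB, formDl hB, formZl hB, formDr hB) (hBC v u) => E1.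
move: E1; set s := B [[a, u], v] w; set t := B [[a, v], u] w.
set c := 4 * _; set c' := 4 * (B a v * _ - _) => E1.
have -> : s + t = c + t + (s + c') - (c + c') by ring.
by rewrite E1 /c /c'; ring.
Qed.

(** By the symmetry of the dual-basis tensor, twice the sum can be computed
    with [imcomm_polar], which gives 4 (a + a - 2 * 7 a). *)
Lemma sum_imcomm_ad a : \sum_i [im_ad a (e i), d i] = - 24 *: a.
Proof.
apply: (scalerI n2); rewrite scalerA.
have swap : \sum_i [[a, e i], d i] = \sum_i [[a, d i], e i].
  apply: (sum_dual_swap hB hBC hBnd (f := fun u v => [[a, u], v])).
  split=> [v|u] c x y.
    by rewrite (bilinDr hcr) (bilinZr hcr) (bilinDl hcr) (bilinZl hcr).
  by rewrite (bilinDr hcr) (bilinZr hcr).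
under eq_bigr do rewrite im_adE.
rewrite scaler_nat mulr2n {2}swap -big_split.
under eq_bigr do rewrite /= imcomm_polar.
rewrite -scaler_sumr sumrB big_split /=.
have -> : \sum_i B a (e i) *: d i = a.
  by rewrite -[RHS](sum_basis_dual hB hBC hBnd); under eq_bigr do rewrite hBC.
have -> : \sum_i B a (d i) *: e i = a.
  by rewrite -[RHS](sum_dual_basis hB hBnd); under eq_bigr do rewrite hBC.
have -> : \sum_i (2 * B (e i) (d i)) *: a = (2 * 7) *: a.
  rewrite -scaler_suml -mulr_sumr; under eq_bigr do rewrite hBC.
  by rewrite (sum_dual_form hB hBnd) (dim_octIm O k2).
rewrite -{1 2}[a]scale1r -scalerDl -scalerBl scalerA; congr (_ *: _); ring.
Qed.

Lemma moment_endo_imcomm0 u v : \sum_i [moment_endo u v (e i), d i] = 0.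
Proof.
under eq_bigr do
  rewrite add_lfunE opp_lfunE !scale_lfunE (bilinBl hcr) !(bilinZl hcr).
rewrite sumrB -!scaler_sumr sum_imcomm_wedge sum_imcomm_ad !scalerA -scalerBl.
rewrite (_ : _ - _ = 0) ?scale0r //; field.
by rewrite n2 -oppr_eq0 opp8_neq0.
Qed.

Lemma trace_rep_moment x u v :
  endo_trace (rep x \o moment_endo u v)%VF = - 3 * B (rep x u) v.
Proof.
have rB y z : rep x (y - z) = rep x y - rep x z by exact: linearB.
have rZ c y : rep x (c *: y) = c *: rep x y by exact: linearZ.
(* The trace is cyclic, and moving brackets across B leaves the pairing of a
   with the vanishing contraction of x. *)
have tr_ad (a : V) : \sum_i B (d i) (rep x [a, e i]) = 0.
  have := endo_traceC (rep x) (im_ad a); rewrite !(endo_traceE hB hBnd).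
  under eq_bigr do rewrite comp_lfunE im_adE.
  move=> ->; transitivity (B (\sum_i [rep x (e i), d i]) a).
    rewrite (form_suml hB); apply: eq_bigr => i _.
    by rewrite comp_lfunE im_adE imcommC (formNr hB) imcomm_skew.
  by rewrite rep_imcomm0 (form0l hB).
have tr_rank1 (w z : V) : \sum_i B w (e i) * B (d i) z = B w z.
  rewrite -[in RHS](sum_dual_basis hB hBnd z) (form_sumr hB).
  by apply: eq_bigr => i _; rewrite (formZr hB) mulrC.
rewrite (endo_traceE hB hBnd).
transitivity (\sum_i (3 / 2 * (B u (e i) * B (d i) (rep x v)
    - B v (e i) * B (d i) (rep x u)) - 8^-1 * B (d i) (rep x [[u, v], e i]))).
  apply: eq_bigr => i _; rewrite comp_lfunE moment_endoE !(rB, rZ).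
  by rewrite !(formBr hB, formZr hB).
rewrite sumrB -2!mulr_sumr sumrB !tr_rank1 tr_ad mulr0 subr0.
rewrite (hBC u) rep_skew (hBC v); field; exact: n2.
Qed.

Lemma moment_endo_special u v w :
  moment_endo u v w + moment_endo u w v =
    B u v *: w + B u w *: v - (2 * B v w) *: u.
Proof.
have -> : moment_endo u v w + moment_endo u w v =
  (3/2) *: (B u w *: v + B u v *: w - (2 * B v w) *: u)
  - 8^-1 *: ([[u, v], w] + [[u, w], v]).
  rewrite !moment_endoE; apply: (form_ext hB hBnd) => z.
  rewrite !(formBl hB, formDl hB, formZl hB) (hBC w v); ring.
rewrite imcomm_polar [B u w *: v + _]addrC scalerA -scalerBl.
rewrite (_ : _ - _ = 1) ?scale1r //; field.
by rewrite n2 -oppr_eq0 opp8_neq0.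
Qed.

(** * The trace form and the moment map *)

Lemma g2_br_bilinear : bilinear_map br.
Proof.
have hl := lbr_bilinear C.
split=> [y|x] a z t; apply: subvs_inj;
  rewrite vsvalP !(vsval_g2_br hC hrho) vsvalP.
  by rewrite (bilinDl hl) (bilinZl hl).
by rewrite (bilinDr hl) (bilinZr hl).
Qed.

Lemma g2_lie : lie_algebra br.
Proof.
split=> [|x|x y z]; first exact: g2_br_bilinear.
  by apply: subvs_inj; rewrite (vsval_g2_br hC hrho) /lbr subrr linear0.
apply: subvs_inj; rewrite !vsvalD !(vsval_g2_br hC hrho) lbr_jacobi.
by rewrite linear0.
Qed.

Lemma rep_brE x y : rep (br x y) = (rep x \o rep y)%VF - (rep y \o rep x)%VF.
Proof.
by apply/lfunP => v; rewrite rep_br add_lfunE opp_lfunE !comp_lfunE.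
Qed.

Lemma g2_formC : symmetric_form BL.
Proof. by move=> x y; rewrite /g2_form endo_traceC. Qed.

Lemma g2_form_bilinear : bilinear_form BL.
Proof.
have linl y : scalar (BL^~ y).
  move=> a x z; rewrite /g2_form rep_linear comp_lfunDl -comp_lfunZl.
  by rewrite endo_trace_linear; ring.
by split=> // x a y z; rewrite !(g2_formC x) linl.
Qed.

Lemma g2_form_invariant x y z : BL (br x y) z = BL x (br y z).
Proof.
rewrite /g2_form !rep_brE; congr (- (_ * _)).
have trB (f g : 'End(V)) : endo_trace (f - g) = endo_trace f - endo_trace g.
  by rewrite -[- g]scaleN1r addrC endo_trace_linear mulN1r addrC.
rewrite comp_lfunDl comp_lfunDr comp_lfunNl comp_lfunNr !trB.
rewrite !comp_lfunA; congr (_ - _).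
by rewrite -[in LHS]comp_lfunA [LHS]endo_traceC.
Qed.

Definition g2_moment u v : L := g2_lift (moment_endo u v).

Lemma rep_moment u v : rep (g2_moment u v) = moment_endo u v.
Proof.
by apply: rep_lift; [apply: moment_endo_skew | apply: moment_endo_imcomm0].
Qed.

Lemma g2_form_moment x u v : BL x (g2_moment u v) = B (rep x u) v.
Proof.
rewrite /g2_form rep_moment trace_rep_moment; field; exact: three_neq0.
Qed.

(** Pairing x with the values of the moment map already detects its action on
    V, and that action is faithful. *)
Lemma g2_form_nondegenerate : nondegenerate BL.
Proof.
move=> x hx; apply: rep_inj; apply/lfunP => u.
have -> : rep 0 = 0.
  by have := rep_linear (-1) 0 0; rewrite scaler0 addr0 scaleN1r addNr.
rewrite lfunE /=; apply: hBnd => v.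
by rewrite -g2_form_moment hx.
Qed.

(** A moment map for a nondegenerate form is determined by its pairings, which
    are bilinear. *)
Lemma g2_moment_bilinear : bilinear_map g2_moment.
Proof.
have hBL := g2_form_bilinear.
split=> [w|u] a y z; apply: (form_ext hBL g2_form_nondegenerate) => x;
  rewrite !(g2_formC _ x) (formDr hBL) (formZr hBL) !g2_form_moment.
  by rewrite linearP (formDl hB) (formZl hB).
by rewrite (formDr hB) (formZr hB).
Qed.

Lemma g2_moment_alt v : g2_moment v v = 0.
Proof.
apply: g2_form_nondegenerate => x; rewrite g2_formC g2_form_moment.
have /eqP := rep_skew x v v; rewrite (hBC v) -addr_eq0 -mulr2n -mulr_natl.
by rewrite mulf_eq0 (negPf n2) => /eqP.
Qed.

End G2.

Theorem theorem4p3 (k : fieldType)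
    (hk2 : 2%N \notin [pchar k]) (hk3 : 3%N \notin [pchar k])
    (O : octonion_algebra k) (C : falgType k)
    (iota : {linear subvs_of (octIm O) -> C})
    (hC : is_clifford (fun u => - onorm (vsval u)) iota)
    (rho : {linear C -> 'End(O)}) (hrho : extends_left_mul iota rho) :
  special_orthogonal_representation
    (@g2_br k O C iota rho) (@g2_form k O C iota rho)
    (@imform k O) (@g2_rep k O C iota rho).
Proof.
split.
- split; first exact: g2_lie.
  split; [exact: g2_form_bilinear | exact: g2_formC
         | exact: g2_form_nondegenerate | exact: g2_form_invariant].
- split; first by split; [exact: imform_bilinear | exact: imformC
                         | exact: imform_nondegenerate].
  split; [exact: rep_linear | exact: rep_br | move=> x v w].
  by rewrite rep_skew // addNr.
- exists (@g2_moment k O C iota rho); split=> [|u v w].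
    split; [exact: g2_moment_bilinear | exact: g2_moment_alt
           | exact: g2_form_moment].
  by rewrite !rep_moment // moment_endo_special.
Qed.
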